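(* Let $k\ge 2$ be an integer. The set $S_\beta=\{\beta_0,\beta_1,\ldots,\beta_{k-2},\tau\}\subset \mathrm{Aut}\,X^{[k]}$, where $\beta_i=\alpha_i$, is a minimal generating set (a generating set of the smallest possible cardinality) of the group $G_k$, and $G_k$ is isomorphic to a Sylow 2-subgroup of the alternating group $A_{2^k}$.
   Context: Let $X=\{0,1\}$ and let $X^{[k]}$ be the finite rooted binary tree with levels $X^0,X^1,\ldots,X^k$ ($X^l$ = words of length $l$; $v$ is joined to $vx$, $x\in X$). The vertices of $X^j$ are numbered from left to right $v_{j,1},\ldots,v_{j,2^j}$ (so $v_{j,1},\dots,v_{j,2^{j-1}}$ lie in the subtree below $v_{1,1}$). For $g\in \mathrm{Aut}\,X^{[k]}$ and a vertex $v$ of level $<k$, the section $g_{(v)}$ is defined by $g(vx)=g(v)g_{(v)}(x)$ for words $x$; its action on the first level below $v$ is the vertex permutation (v.p.) of $g$ at $v$. It is active, $s_{j,i}(g)=1$, if it is the nontrivial permutation of $X$ at $v=v_{j,i}$, and trivial, $s_{j,i}(g)=0$, otherwise. For $0\le l\le k-2$, $\alpha_l$ is the automorphism whose only active v.p. is at $v_{l,1}$. $\tau=\tau_{1,2^{k-1}}$ is the automorphism whose only active v.p.'s are at $v_{k-1,1}$ and $v_{k-1,2^{k-1}}$. $B_{k-1}=\mathrm{Aut}\,X^{[k-1]}\simeq C_2\wr\cdots\wr C_2$ ($k-1$ factors) is viewed as the subgroup of $\mathrm{Aut}\,X^{[k]}$ of automorphisms having trivial v.p. at all vertices of $X^{k-1}$.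 $W_{k-1}$ is the subgroup of $\mathrm{Aut}\,X^{[k]}$ of automorphisms whose active v.p.'s all lie on $X^{k-1}$ and are even in number. $G_k=B_{k-1}\ltimes W_{k-1}$ is the subgroup of $\mathrm{Aut}\,X^{[k]}$ generated by $B_{k-1}$ and $W_{k-1}$, where $B_{k-1}$ acts on $W_{k-1}$ by conjugation. *)

(* Defs.v *)
From mathcomp Require Import all_boot all_fingroup all_solvable.

Set Implicit Arguments.
Unset Strict Implicit.
Unset Printing Implicit Defensive.

Local Open Scope group_scope.

Section BinaryTree.

Variable k : nat.

(* Vertices of X^[k]: words of length at most k over X = {0,1}, with
   0 = false and 1 = true; the root is the empty word and the level is
   the length. *)
Definition vertex := k.-bseq bool.

Definition root : vertex := [bseq].

(* The word w as a vertex; only meaningful when size w <= k. *)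
Definition vtx (w : seq bool) : vertex := insub_bseq k w.

Definition child (u v : vertex) : bool :=
  [exists x : bool, val v == rcons u x].

Definition adj (u v : vertex) : bool := child u v || child v u.

(* MathComp composes permutations from left to right:
   (g * h) v = h (g v). *)
Definition AutX : {set {perm vertex}} :=
  [set g : {perm vertex} | (g root == root)
     && [forall u : vertex, forall v : vertex, adj (g u) (g v) == adj u v]].

(* The section of g at v, characterised by g (v x) = g v ++ vsection g v x;
   see sectionE. *)
Definition vsection (g : {perm vertex}) (v x : seq bool) : seq bool :=
  drop (size v) (g (vtx (v ++ x))).

(* s_{j,i}(g) for v = v_{j,i}; only meaningful when size v < k. *)
Definition active (g : {perm vertex}) (v : seq bool) : bool :=
  [exists x : bool, vsection g v [:: x] != [:: x]].

(* v_{j,i}, for 1 <= i <= 2 ^ j: the j binary digits of i - 1, most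
   significant digit first. *)
Definition v_ (j i : nat) : seq bool :=
  mkseq (fun t => odd (i.-1 %/ 2 ^ (j.-1 - t))) j.

(* The image of the word w below u under the automorphism whose active
   vertex permutations are those at the v with P v, where u is the
   part of the word already read. *)
Fixpoint act_from (P : pred (seq bool)) (u w : seq bool) : seq bool :=
  if w is x :: w' then (x (+) P u) :: act_from P (rcons u x) w' else [::].

Lemma size_act_from P u w : size (act_from P u w) = size w.
Proof. by elim: w u => //= x w IH u; rewrite IH. Qed.

Lemma act_from_inj P u : injective (act_from P u).
Proof.
move=> w1 w2; elim: w1 u w2 => [|x w1 IH] u [|y w2] //= [Exy].
have -> : x = y by move: Exy; case: x; case: y; case: (P u).
by move/IH->.
Qed.

Lemma portrait_subproof P (v : vertex) : size (act_from P [::] v) <= k.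
Proof. by rewrite size_act_from size_bseq. Qed.

Definition portrait_fun P (v : vertex) : vertex := Bseq (portrait_subproof P v).

Lemma portrait_fun_inj P : injective (portrait_fun P).
Proof. by move=> u v /(congr1 val) /= /act_from_inj /val_inj. Qed.

(* The unique automorphism active at v exactly when P v, for all v of level
   < k; see portrait_aut_in, portrait_autP and portrait_aut_uniq. *)
Definition portrait_aut P : {perm vertex} := perm (@portrait_fun_inj P).

Definition alpha (l : nat) : {perm vertex} := portrait_aut (pred1 (v_ l 1)).

(* tau_{1, 2^(k-1)} *)
Definition tau : {perm vertex} :=
  portrait_aut (pred2 (v_ k.-1 1) (v_ k.-1 (2 ^ k.-1))).

(* B_ and W_ are B_{k-1} and W_{k-1}, inside Aut X^[k]. *)
Definition B_ : {set {perm vertex}} :=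
  [set g in AutX | [forall v : vertex, (size v == k.-1) ==> ~~ active g v]].

Definition W_ : {set {perm vertex}} :=
  [set g in AutX |
     [forall v : vertex, (size v < k) && active g v ==> (size v == k.-1)]
     && ~~ odd #|[set v : vertex | (size v == k.-1) && active g v]|].

Definition G_ : {set {perm vertex}} := <<B_ :|: W_>>.

Definition S_beta : {set {perm vertex}} :=
  [set alpha i | i : 'I_k.-1] :|: [set tau].

Lemma vtxE w : size w <= k -> vtx w = w :> seq bool.
Proof. by move=> sw; rewrite /vtx /insub_bseq val_insubd sw. Qed.

Lemma vtxK (v : vertex) : vtx v = v.
Proof. by apply: val_inj; rewrite /= vtxE // size_bseq. Qed.

Lemma AutX_child g (u v : vertex) :
  g \in AutX -> child u v -> child (g u) (g v).
Proof.
rewrite inE => /andP[/eqP g1 /forallP gA].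
have {}gA a b : adj (g a) (g b) = adj a b by apply/eqP/(forallP (gA a)).
have childP (a b : vertex) : reflect (exists x, val b = rcons a x) (child a b).
  by apply: (iffP existsP) => -[x e]; exists x; exact/eqP.
move: {2}(size u) (erefl (size u)) => n.
elim: n u v => [|n IH] u v su uv; have := gA u v; rewrite /adj uv /=.
  have -> : u = root by exact/val_inj/size0nil.
  by rewrite g1 => /orP[//|/childP[x]]; case: (g v : seq bool).
case/orP=> // gvu; case/lastP E: (u : seq bool) su => [|w x] //.
rewrite size_rcons => -[sw].
have swk : size w <= k.
  by rewrite -ltnS -(size_rcons w x) -E (leq_trans (size_bseq u)).
have wu : child (vtx w) u.
  by apply/childP; exists x; rewrite /= vtxE // E.
have gwu := IH _ _ (etrans (congr1 size (vtxE swk)) sw) wu.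
have e : v = vtx w.
  apply: (@perm_inj _ g); apply: val_inj.
  case/childP: gvu => y; case/childP: gwu => z -> /eqP.
  by rewrite eqseq_rcons => /andP[/eqP ew _]; exact/esym.
case/childP: uv => y; rewrite e /= vtxE // E => /(congr1 size).
by rewrite !size_rcons; elim: (size w) => // m IHm [].
Qed.

Lemma AutX_rcons g w x : g \in AutX -> size w < k ->
  exists y, g (vtx (rcons w x)) = rcons (g (vtx w)) y :> seq bool.
Proof.
move=> gA sw; have /(AutX_child gA)/existsP[y /eqP e] : child (vtx w) (vtx (rcons w x)).
  by apply/existsP; exists x; rewrite /= !vtxE ?size_rcons // ltnW.
by exists y.
Qed.

Lemma size_AutX g (v : vertex) : g \in AutX -> size (g v) = size v.
Proof.
move=> gA; rewrite -{1}[v]vtxK; move: (size_bseq v).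
elim/last_ind: {v}(v : seq bool) => [_|w x IH].
  rewrite (_ : vtx [::] = root); last exact/val_inj/vtxE.
  by move: gA; rewrite inE => /andP[/eqP->].
rewrite size_rcons => sw; have [y ->] := AutX_rcons x gA sw.
by rewrite size_rcons IH // ltnW.
Qed.

Lemma sectionE g v x : g \in AutX -> size v + size x <= k ->
  g (vtx (v ++ x)) = g (vtx v) ++ vsection g v x :> seq bool.
Proof.
move=> gA; rewrite /vsection.
elim/last_ind: x => [|x a IH].
  rewrite addn0 cats0 => sv.
  by rewrite drop_oversize ?cats0 // size_AutX // vtxE.
rewrite size_rcons addnS -size_cat => s; rewrite -rcons_cat.
have [y ->] := AutX_rcons a gA s.
have {}IH := IH (ltnW (eq_ind _ (fun n => n < k) s _ (size_cat v x))).
rewrite drop_rcons; last by rewrite size_AutX // vtxE ?size_cat ?leq_addr // -size_cat ltnW.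
by rewrite -rcons_cat -IH.
Qed.

Lemma act_from_cat P u w1 w2 :
  act_from P u (w1 ++ w2) = act_from P u w1 ++ act_from P (u ++ w1) w2.
Proof.
by elim: w1 u => [|x w1 IH] u /=; rewrite ?cats0 // IH cat_rcons.
Qed.

Lemma portrait_aut_in P : portrait_aut P \in AutX.
Proof.
have childE a b : child (portrait_fun P a) (portrait_fun P b) = child a b.
  apply/existsP/existsP => /= -[x /eqP e]; last first.
    by exists (x (+) P a); rewrite e -!cats1 act_from_cat.
  have := congr1 size e; rewrite size_rcons !size_act_from.
  case/lastP E: (b : seq bool) e => [|w y] //.
  rewrite -cats1 act_from_cat /= cats1 => /eqP.
  rewrite eqseq_rcons => /andP[/eqP/act_from_inj<- _] _.
  by exists y; rewrite cats1.
rewrite inE permE; apply/andP; split; first exact/eqP/val_inj.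
by apply/forallP=> u; apply/forallP=> v; rewrite !permE /adj !childE.
Qed.

Lemma portrait_autP P v : size v < k -> active (portrait_aut P) v = P v.
Proof.
move=> sv; have E x : vsection (portrait_aut P) v [:: x] = [:: x (+) P v].
  rewrite /vsection permE /= vtxE ?size_cat ?addn1 // act_from_cat /=.
  by rewrite drop_size_cat ?size_act_from.
by apply/existsP/idP => [[x]|Pv]; [|exists true]; rewrite E ?Pv //; case: x; case: (P v).
Qed.

Lemma portrait_aut_uniq P g : g \in AutX ->
  (forall v, size v < k -> active g v = P v) -> g = portrait_aut P.
Proof.
move=> gA gP; apply/permP=> v; apply: val_inj; rewrite permE /=.
rewrite -{1}[v]vtxK; move: (size_bseq v).
elim/last_ind: {v}(v : seq bool) => [_|w x IH].
  rewrite (_ : vtx [::] = root); last exact/val_inj/vtxE.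
  by move: gA; rewrite inE => /andP[/eqP->].
rewrite size_rcons => sw; rewrite -cats1 act_from_cat /=.
have E z : exists y, vsection g w [:: z] = [:: y].
  have := congr1 size (sectionE gA (_ : size w + size [:: z] <= k)).
  rewrite addn1 size_cat !size_AutX // !vtxE ?size_cat ?addn1 ?(ltnW sw) // => /(_ sw).
  rewrite -addn1 => /addnI; case: (vsection g w [:: z]) => [|y [|]] //; by exists y.
have inj : vsection g w [:: true] <> vsection g w [:: false].
  move=> e; have := sectionE gA (_ : size w + size [:: true] <= k).
  rewrite addn1 e => /(_ sw); rewrite -sectionE ?addn1 // => /val_inj/perm_inj/(congr1 val).
  rewrite /= !vtxE ?size_cat ?addn1 // => /eqP.
  by rewrite !cats1 eqseq_rcons andbF.
rewrite sectionE ?addn1 // IH ?(ltnW sw) //; congr (_ ++ _).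
have [t Et] := E true; have [f Ef] := E false; rewrite Et Ef in inj.
rewrite -gP //.
have -> : active g w = ~~ t.
  apply/existsP/idP => [[[]]|nt]; rewrite ?Et ?Ef; last first.
  - by exists true; rewrite Et; case: t nt {Et inj}.
  - by case: f t inj {Et Ef} => [] [].
  - by case: t {Et inj}.
by case: x; rewrite ?Et ?Ef; case: t f inj {Et Ef} => [] [].
Qed.

End BinaryTree.

(* Main.v *)
Require Import Defs.
From mathcomp Require Import all_boot all_fingroup all_solvable.
Local Open Scope group_scope.

Set Implicit Arguments.
Unset Strict Implicit.
Unset Printing Implicit Defensive.

(** An automorphism g of the binary tree of depth k is determined by its set
    of active vertices, and activity behaves like a cocycle:
    active (g * h) v = active g v (+) active h (g v).  Summed modulo 2 over a
    set of vertices that the automorphisms preserve, this gives homomorphisms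
    to Z/2.  Let evenG be the kernel of the one attached to level k-1; it
    turns out to be G_k.

    Generation.  Let delta v be the automorphism active at v only.  Since
    g * delta (g v) differs in activity from g exactly at v, every automorphism
    is a product of deltas, and delta v ^ h = delta (h v) as soon as h is
    inactive strictly below v.  Conjugating alpha_l by automorphisms that move
    the leftmost vertex of level l to any other one yields by induction on l all
    deltas above level k-1 (delta_upper_in); conjugating tau yields all products
    delta v * delta r on level k-1, with r its rightmost vertex (delta_pair_in).
    Hence each automorphism is, up to a factor delta r recording its parity on
    level k-1, in the group generated by S_beta (AutX_coset).  This gives
    <<S_beta>> = evenG = G_k, and that this group has index at most 2.

    Minimality.  On evenG the parity of the activity in the left half of level
    k-1 is also a homomorphism, because exchanging the halves does not change
    it.  With the parities of levels 0, ..., k-2 this makes k homomorphisms to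
    Z/2 that are dual to S_beta (level_char_beta), so the 2 ^ k sums of them are
    distinct and are told apart by their values on any generating set T, whence
    2 ^ k <= 2 ^ #|T| (leq_card_gen).

    Sylow.  The tree has 2 ^ k - 1 inner vertices, so evenG has order at least
    2 ^ (2 ^ k - 2), which is the 2-part of the order of the alternating group
    of degree 2 ^ k (Alt_part2).  Automorphisms act faithfully on the leaves, and
    the generators act evenly: alpha_i commutes with the flip of the last letter
    and preserves the last letter, so it does the same thing on two disjoint
    copies of half the leaves (leaf_perm_upper), while tau is a product of two
    conjugate involutions (leaf_perm_tau). *)

(** * Portraits and vertex involutions *)

Section Portraits.

Variable k : nat.
Implicit Types (g h : {perm vertex k}) (u v : vertex k).
Implicit Types (w : seq bool) (P : pred (seq bool)).

Lemma AutX_portrait g : g \in AutX k -> g = portrait_aut k (active g).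
Proof. by move=> gA; apply: portrait_aut_uniq. Qed.

Lemma AutXE g v : g \in AutX k -> g v = act_from (active g) [::] v :> seq bool.
Proof. by move=> gA; rewrite {1}(AutX_portrait gA) permE. Qed.

Lemma AutX_vtx_rcons g v x : g \in AutX k -> size v < k ->
  g (vtx k (rcons v x)) = rcons (g v) (x (+) active g v) :> seq bool.
Proof.
move=> gA sv; rewrite !AutXE // vtxE ?size_rcons //.
by rewrite -!cats1 act_from_cat.
Qed.

Lemma AutX_eq g h : g \in AutX k -> h \in AutX k ->
  (forall v, size v < k -> active g v = active h v) -> g = h.
Proof.
move=> gA hA e; rewrite (AutX_portrait hA); apply: portrait_aut_uniq => // v sv.
by have := e (vtx k v); rewrite vtxE ?(ltnW sv) //; apply.
Qed.

Lemma AutX_group_set : group_set (AutX k).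
Proof.
apply/group_setP; split=> [|g h].
  rewrite inE perm1 eqxx; apply/forallP=> u; apply/forallP=> v.
  by rewrite !perm1.
rewrite !inE => /andP[/eqP gr /forallP gP] /andP[/eqP hr /forallP hP].
rewrite permM gr hr eqxx; apply/forallP=> u; apply/forallP=> v.
by rewrite !permM (eqP (forallP (hP _) _)) (eqP (forallP (gP _) _)).
Qed.

Canonical AutX_group := Group AutX_group_set.

(** Compare the last letters of the images of a child of v: g followed by h
    flips it once for each of the two vertices v and g v that is active. *)
Lemma activeM g h v : g \in AutX k -> h \in AutX k -> size v < k ->
  active (g * h) v = active g v (+) active h (g v).
Proof.
move=> gA hA sv; have ghA : g * h \in AutX k by rewrite groupM.
have := AutX_vtx_rcons false ghA sv; rewrite permM.
have -> : g (vtx k (rcons v false)) = vtx k (rcons (g v) (active g v)).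
  apply: val_inj; rewrite /= AutX_vtx_rcons // vtxE //.
  by rewrite size_rcons size_AutX.
rewrite AutX_vtx_rcons ?size_AutX // => /eqP.
by rewrite eqseq_rcons => /andP[_ /eqP].
Qed.

Lemma active1 v : size v < k -> active (1 : {perm vertex k}) v = false.
Proof.
move=> sv; have := activeM (group1 AutX_group) (group1 AutX_group) sv.
by rewrite mulg1 perm1; case: active.
Qed.

Lemma act_from_id P (u w : seq bool) :
  (forall i, i < size w -> ~~ P (u ++ take i w)) -> act_from P u w = w.
Proof.
elim: w u => //= x w IH u Pu.
have := Pu 0 isT; rewrite cats0 => /negbTE->; rewrite addbF IH // => i iw.
by rewrite cat_rcons (Pu i.+1).
Qed.

(** The image of a word is only changed at the proper prefixes that are active. *)
Lemma AutX_below_fix g n v : g \in AutX k ->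
  (forall u, size u < n -> size u < k -> ~~ active g u) -> size v <= n -> g v = v.
Proof.
move=> gA ginact sv; apply: val_inj; rewrite /= AutXE // act_from_id // => i iv.
have ik : i < k by apply: leq_trans iv (size_bseq v).
have si : size (take i v) = i by rewrite size_take iv.
have := ginact (vtx k (take i v)); rewrite vtxE si ?(ltnW ik) //.
by apply=> //; apply: leq_trans sv.
Qed.

Definition delta (v : seq bool) := portrait_aut k (pred1 v).

Lemma delta_in w : delta w \in AutX k.
Proof. exact: portrait_aut_in. Qed.

Lemma active_delta w v : size v < k -> active (delta w) v = (val v == w).
Proof. by move=> sv; rewrite portrait_autP. Qed.

Lemma delta_fix w v : size v <= size w -> delta w v = v.
Proof.
move=> svw; apply: (AutX_below_fix (n := size w)) => // [|u su uk].
  exact: delta_in.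
by rewrite active_delta //; apply: contraTneq su => ->; rewrite ltnn.
Qed.

Lemma deltaK w : delta w * delta w = 1.
Proof.
apply: AutX_eq; rewrite ?groupM ?group1 ?delta_in // => v sv.
rewrite activeM ?delta_in // active1 // !active_delta ?size_AutX ?delta_in //.
have [e|] := eqVneq (val v) w; first by rewrite delta_fix ?e ?eqxx // -e.
move=> ne; apply/negbTE; apply: contra ne => /eqP e.
by rewrite -e delta_fix // -e size_AutX ?delta_in.
Qed.

(** Conjugating by h moves the active vertex from v to h v, but also moves the
    activity of h below v, since delta v exchanges the two subtrees there; hence
    the hypothesis on h. *)
Lemma deltaJ v h : h \in AutX k ->
  (forall u, size v < size u -> size u < k -> ~~ active h u) ->
  delta v ^ h = delta (h v).
Proof.
move=> hA hP; have dA := delta_in; apply: (mulgI h); rewrite -conjgC.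
apply: AutX_eq; rewrite ?groupM ?delta_in // => u su.
rewrite !activeM // !active_delta ?size_AutX // !(inj_eq val_inj).
rewrite (inj_eq perm_inj) addbC; congr (_ (+) _).
have [/delta_fix->//|suv] := leqP (size u) (size v).
by rewrite !(negbTE (hP _ _ _)) ?size_AutX.
Qed.

Lemma active_mul_delta g v u : g \in AutX k -> size u < k ->
  active (g * delta (g v)) u = active g u (+) (u == v).
Proof.
move=> gA su; rewrite activeM ?delta_in // active_delta ?size_AutX //.
by rewrite (inj_eq val_inj) (inj_eq perm_inj).
Qed.

Lemma mulg_deltaK w g : g * delta w * delta w = g.
Proof. by rewrite -mulgA deltaK mulg1. Qed.

(** By active_mul_delta the factor delta (g v) removes v from the active
    vertices of g and changes nothing else, so this is an induction on their
    number; v may be any of them. *)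
Lemma AutX_ind (K : {perm vertex k} -> Prop) :
  K 1 ->
  (forall g v, g \in AutX k -> size v < k -> active g v ->
     K (g * delta (g v)) -> K g) ->
  forall g, g \in AutX k -> K g.
Proof.
move=> K1 Kstep g; pose A h := [set u : vertex k | (size u < k) && active h u].
have [n] := ubnP #|A g|; elim: n g => // n IH g /ltnSE-gn gA.
have [A0|[v]] := set_0Vmem (A g).
  suff -> : g = 1 by [].
  apply: AutX_eq; rewrite ?group1 // => v sv; rewrite active1 //.
  by have := in_set0 v; rewrite -A0 inE sv.
rewrite inE => /andP[sv av]; apply: (Kstep _ v) => //.
apply: IH; last by rewrite groupM ?delta_in.
apply: leq_trans gn; apply: proper_card; rewrite properE; apply/andP; split.
  apply/subsetP => u; rewrite !inE => /andP[su]; rewrite su active_mul_delta //.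
  by have [->|] := eqVneq u v; rewrite ?av ?addbF.
apply/subsetPn; exists v; rewrite !inE sv ?av //.
by rewrite active_mul_delta // av eqxx.
Qed.

(** Peeling off active vertices only uses deltas of the levels on which g is
    active.  The restriction to the levels L is essential below: no delta of
    level k-1 lies in the group generated by S_beta. *)
Lemma mem_of_deltas (L : pred nat) (H : {group {perm vertex k}}) :
  (forall v, size v < k -> L (size v) -> delta v \in H) ->
  forall g, g \in AutX k ->
  (forall v, size v < k -> active g v -> L (size v)) -> g \in H.
Proof.
move=> dH; apply: (AutX_ind (K := fun g => _ -> g \in H)) => [_|g v gA sv av IH gL].
  exact: group1.
rewrite -(groupMr g (dH (g v) _ _)) ?size_AutX ?gL //; apply: IH => u su.
by rewrite active_mul_delta //; have [-> _|_] := eqVneq u v; rewrite ?addbF; apply: gL.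
Qed.

(** * Parities of the activity on sets of vertices *)
Definition parity (A : pred (vertex k)) g := \big[addb/false]_(v | A v) active g v.

Lemma odd_card_parity A g :
  odd #|[set v : vertex k | A v && active g v]| = parity A g.
Proof.
rewrite -sum1_card (big_morph odd oddD (erefl _)) /= big_mkcond [RHS]big_mkcond /=.
by apply: eq_bigr => v _; rewrite inE; case: (A v); case: active.
Qed.

(** When g maps A onto A', the cocycle identity sums to additivity; A and A'
    differ when g exchanges the two halves of a level. *)
Lemma parityM (A A' : pred (vertex k)) g h : g \in AutX k -> h \in AutX k ->
  (forall v, A v -> size v < k) -> (forall v, size v < k -> A' (g v) = A v) ->
  (forall v, A' v -> size v < k) ->
  parity A (g * h) = parity A g (+) parity A' h.
Proof.
move=> gA hA Ak gAA A'k; rewrite /parity.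
rewrite (eq_bigr _ (fun v Av => activeM gA hA (Ak v Av))) big_split /=.
congr (_ (+) _); rewrite [RHS](reindex_inj (perm_inj (s := g))).
apply: eq_bigl => v; have [sv|sv] := ltnP (size v) k; first by rewrite gAA.
have /negbTE-> : ~~ A v by apply: contraL sv => /Ak; rewrite -ltnNge.
by apply/esym/negbTE; apply: contraL sv => /A'k; rewrite size_AutX // -ltnNge.
Qed.

Lemma big_addb_pred1 (I : finType) (A : pred I) (v : I) :
  \big[addb/false]_(u | A u) (u == v) = A v.
Proof.
have [Av|nAv] := boolP (A v).
  by rewrite (bigD1 v) //= eqxx big1 // => u /andP[_ /negbTE].
by rewrite big1 // => u; have [->|] := eqVneq u v; rewrite ?(negbTE nAv).
Qed.

Lemma parity_mul_delta (A : pred (vertex k)) g v : g \in AutX k ->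
  (forall v, A v -> size v < k) -> parity A (g * delta (g v)) = parity A g (+) A v.
Proof.
move=> gA Ak; rewrite /parity -(big_addb_pred1 A v) -big_split /=.
by apply: eq_bigr => u /Ak su; rewrite active_mul_delta.
Qed.

Lemma parity_delta (A : pred (vertex k)) v :
  (forall v, A v -> size v < k) -> parity A (delta v) = A v.
Proof.
move=> Ak; rewrite -(big_addb_pred1 A v).
by apply: eq_bigr => u /Ak su; rewrite active_delta.
Qed.

End Portraits.

Lemma v_first l : v_ l 1 = nseq l false.
Proof.
apply: (@eq_from_nth _ false); first by rewrite size_mkseq size_nseq.
by move=> i; rewrite size_mkseq => il; rewrite nth_mkseq // nth_nseq il div0n.
Qed.

Lemma v_last l : v_ l (2 ^ l) = nseq l true.
Proof.
apply: (@eq_from_nth _ false); first by rewrite size_mkseq size_nseq.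
move=> i; rewrite size_mkseq => il; rewrite nth_mkseq // nth_nseq il.
(* The quotient of 2 ^ l - 1 by 2 ^ m is 2 ^ (i + 1) - 1, an odd number. *)
set m := l.-1 - i.
have -> : l = (i.+1 + m)%N by rewrite /m; case: l il {m} => // l il; rewrite addSn subnKC.
have p0 n : 0 < 2 ^ n by rewrite expn_gt0.
have -> : (2 ^ (i.+1 + m)).-1 = ((2 ^ i.+1).-1 * 2 ^ m + (2 ^ m).-1)%N.
  by rewrite -!subn1 addnBA // mulnBl mul1n -expnD subnK // leq_exp2l // leq_addl.
by rewrite divnMDl // divn_small ?addn0 ?prednK // -subn1 oddB // oddX.
Qed.

(** * Generation by S_beta *)

Section Generation.

Variable k : nat.
Hypothesis hk : 2 <= k.
Implicit Types (g h : {perm vertex k}) (u v : vertex k) (w : seq bool).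

Local Notation K := <<S_beta k>>.
Local Notation delta := (delta k).
Local Notation zeros := (nseq k.-1 false).
Local Notation ones := (nseq k.-1 true).

Lemma k1_lt : k.-1 < k. Proof. by rewrite prednK // ltnW. Qed.
Hint Resolve k1_lt : core.
Lemma k1_gt0 : 0 < k.-1. Proof. by case: k hk => [|[]]. Qed.
Hint Resolve k1_gt0 : core.

Lemma alphaE l : alpha k l = delta (nseq l false).
Proof. by rewrite /alpha v_first. Qed.

Lemma zeros_neq_ones : zeros != ones.
Proof. by case: k.-1 k1_gt0. Qed.

Lemma tau_active v : size v < k ->
  active (tau k) v = (val v == zeros) || (val v == ones).
Proof. by move=> sv; rewrite portrait_autP // v_first v_last. Qed.

Lemma tauE : tau k = delta zeros * delta ones.
Proof.
apply: AutX_eq; rewrite ?groupM ?delta_in ?portrait_aut_in // => v sv.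
rewrite activeM ?delta_in // !active_delta ?size_AutX ?delta_in //.
rewrite tau_active //.
have sz : size zeros = size ones by rewrite !size_nseq.
have -> : (val (delta zeros v) == ones) = (val v == ones).
  apply/eqP/eqP => e; last by rewrite delta_fix // e sz.
  by rewrite -e delta_fix // sz -e size_AutX ?delta_in.
by have [->|] := eqVneq (val v) zeros; rewrite ?(negbTE zeros_neq_ones).
Qed.

(** Activity on the leftmost branch only, prescribed by the letters of w: this
    moves the leftmost vertex of level (size w) to w and, if w starts with false,
    leaves the right half of the tree fixed. *)
Definition spine w :=
  portrait_aut k (fun u : seq bool => (u == nseq (size u) false) && nth false w (size u)).

Lemma spine_in w : spine w \in AutX k.
Proof. exact: portrait_aut_in. Qed.

Lemma spine_active w v : size v < k -> active (spine w) v -> size v < size w.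
Proof.
move=> sv; rewrite portrait_autP // => /andP[_]; apply: contraTltn => ?.
by rewrite nth_default.
Qed.

Lemma spine_zeros v : spine (val v) (vtx k (nseq (size v) false)) = v.
Proof.
apply: val_inj; rewrite /= permE /= vtxE ?size_nseq ?size_bseq //.
have gen (P : pred (seq bool)) w i : (forall t, P (nseq (i + t) false) = nth false w t) ->
    act_from P (nseq i false) (nseq (size w) false) = w.
  elim: w i => //= x w IH i Px; have := Px 0; rewrite addn0 /= => ->.
  by rewrite -cats1 -(nseqD i 1) addn1 IH // => t; rewrite addSnnS Px.
by apply: (gen _ _ 0) => t; rewrite size_nseq eqxx.
Qed.

Lemma spine_ones v : ~~ head false v -> spine (val v) (vtx k ones) = vtx k ones.
Proof.
move=> v0; apply: val_inj; rewrite /= permE /= vtxE ?size_nseq ?(ltnW k1_lt) //.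
apply: act_from_id => -[|i] io /=; first by rewrite take0 /= nth0 (negbTE v0).
by rewrite size_nseq in io; case: k.-1 io.
Qed.

(** The automorphism spine v is active above v only, so by induction it is
    generated, and it conjugates alpha_l to delta v, with l the level of v. *)
Lemma delta_upper_in v : size v < k.-1 -> delta v \in K.
Proof.
have [l] := ubnP (size v); elim: l v => // l IH v /ltnSE-sv vk.
have hK : spine (val v) \in K.
  apply: (mem_of_deltas (L := fun n => n < size v)) => [u suk su||u suk].
  - by apply: IH; [apply: leq_trans sv | apply: ltn_trans vk].
  - exact: spine_in.
  - exact: spine_active.
rewrite -{1}(spine_zeros v) -deltaJ ?spine_in //; last first.
  move=> u; rewrite vtxE ?size_nseq ?size_bseq // => svu suk.
  by apply/negP => /(spine_active suk); rewrite ltnNge ltnW.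
rewrite groupJ // vtxE ?size_nseq ?size_bseq // -alphaE.
apply: mem_gen; rewrite !inE; apply/orP; left.
by apply/imsetP; exists (Ordinal vk).
Qed.

Lemma upper_in g : g \in AutX k ->
  (forall v, size v < k -> active g v -> size v < k.-1) -> g \in K.
Proof.
move=> gA; apply: (mem_of_deltas (L := fun n => n < k.-1)) => // v _.
exact: delta_upper_in.
Qed.

Lemma vtx_ones : vtx k ones = ones :> seq bool.
Proof. by rewrite vtxE // size_nseq ltnW. Qed.

Lemma delta2J u v h : h \in AutX k -> size u = k.-1 -> size v = k.-1 ->
  (delta u * delta v) ^ h = delta (h u) * delta (h v).
Proof.
move=> hA su sv; rewrite conjMg !deltaJ // => x; rewrite ?su ?sv => lx xk;
  by have := leq_ltn_trans lx xk; rewrite prednK ?ltnn // ltnW.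
Qed.

(** For v in the left half, spine v fixes the last vertex and conjugates tau to
    the required product.  A vertex of the right half is first moved to the left
    by the flip h at the root, which sends the last vertex to the left half too. *)
Lemma delta_pair_in v : size v = k.-1 -> delta v * delta ones \in K.
Proof.
have left_case u : size u = k.-1 -> ~~ head false u -> delta u * delta ones \in K.
  move=> su u0; have hK : spine (val u) \in K.
    apply: upper_in; first exact: spine_in.
    by move=> x sx; rewrite -su; apply: spine_active.
  have -> : delta u * delta ones = tau k ^ spine (val u).
    rewrite tauE -{1}(spine_zeros u) -{1}vtx_ones -{1}(spine_ones u0).
    by rewrite -delta2J ?spine_in ?vtx_ones ?vtxE ?su ?size_nseq // ltnW.
  by rewrite groupJ //; apply: mem_gen; rewrite !inE eqxx orbT.
move=> sv; case: (boolP (head false v)) => [v1|]; last exact: left_case.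
set h := delta [::]; have hA : h \in AutX k by exact: delta_in.
have hK : h \in K by exact: (delta_upper_in (v := Defs.root k) k1_gt0).
have head_h u : size u = k.-1 -> head false (h u) = ~~ head false u.
  rewrite AutXE //; case E: (u : seq bool) => [|x s] /=; first by move: k1_gt0 => /[swap]<-.
  have -> := @active_delta k [::] (Defs.root k) (ltnW hk).
  by rewrite addbT.
have s1 : size (vtx k ones) = k.-1 by rewrite vtx_ones size_nseq.
have A1 : delta (h v) * delta ones \in K by rewrite left_case ?size_AutX ?head_h ?v1.
have A2 : delta (h (vtx k ones)) * delta ones \in K.
  rewrite left_case ?size_AutX ?head_h // vtx_ones.
  by case: k.-1 k1_gt0.
rewrite -(groupJr _ hK) -vtx_ones delta2J ?size_AutX // in A1.
have hh u : h (h u) = u by rewrite -permM deltaK perm1.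
by have := groupM A1 A2; rewrite hh mulgA mulg_deltaK.
Qed.

Definition bottom_parity := parity (fun v : vertex k => size v == k.-1).

Lemma level_lt v : size v == k.-1 -> size v < k.
Proof. by move/eqP->. Qed.

(** Vertices are peeled off g one at a time.  At a vertex above level k-1 the
    removed factor has to be moved past delta ones, which costs the product of
    delta ones and a conjugate of it, of the form treated by delta_pair_in. *)
Lemma AutX_coset g : g \in AutX k -> g * delta ones ^+ bottom_parity g \in K.
Proof.
move: g; apply: AutX_ind => [|g v gA sv av].
  rewrite /bottom_parity /parity big1 ?mulg1 ?group1 // => v /level_lt; exact: active1.
rewrite /bottom_parity parity_mul_delta //; last exact: level_lt.
rewrite -/bottom_parity; set d := delta (g v); set b := bottom_parity g.
have sgv : size (g v) = size v by rewrite size_AutX.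
set r := delta ones; have dd : d * d = 1 by exact: deltaK.
have rr : r * r = 1 by exact: deltaK.
have ddK x : x * d * d = x by rewrite -mulgA dd mulg1.
have rrK x : x * r * r = x by rewrite -mulgA rr mulg1.
have d1 : d^-1 = d by apply/eqP; rewrite eq_invg_mul dd.
have r1 : r^-1 = r by apply/eqP; rewrite eq_invg_mul rr.
have [e|ne] := eqVneq (size v) k.-1.
  have drK : d * r \in K by rewrite delta_pair_in ?sgv.
  case: b => /= gdK.
    by have := groupM gdK drK; rewrite mulg1 mulgA ddK.
  have := groupM gdK (groupVr drK).
  by rewrite invMg d1 r1 !mulgA rrK ddK mulg1.
have vk : size v < k.-1 by rewrite ltn_neqAle ne /= -ltnS prednK // ltnW.
have dK : d \in K by rewrite delta_upper_in ?sgv.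
rewrite addbF; case: b => /= gdK; last first.
  by have := groupM gdK dK; rewrite !mulg1 ddK.
have s1 : size (vtx k ones) = k.-1 by rewrite vtx_ones size_nseq.
have rdr : r ^ d * r \in K.
  rewrite /r -{1}vtx_ones deltaJ ?delta_in //.
    by rewrite delta_pair_in ?size_AutX ?delta_in.
  move=> u; rewrite s1 => ku uk; rewrite active_delta //.
  apply: contraL vk => /eqP/(congr1 size); rewrite sgv => <-.
  by rewrite -leqNgt ltnW.
have := groupM gdK (groupM dK rdr).
by rewrite conjgE d1 !mulgA ddK rrK ddK.
Qed.

Lemma parity_tau (A : pred (vertex k)) : (forall v, A v -> size v < k) ->
  parity A (tau k) = A (vtx k zeros) (+) A (vtx k ones).
Proof.
move=> Ak; rewrite -!(big_addb_pred1 A) -big_split /=.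
apply: eq_bigr => v /Ak sv; rewrite tau_active // -!(inj_eq val_inj) /=.
rewrite !vtxE ?size_nseq ?(ltnW k1_lt) //.
by have [->|] := eqVneq (val v) zeros; rewrite ?(negbTE zeros_neq_ones).
Qed.

Definition evenG := [set g in AutX k | ~~ bottom_parity g].

Lemma in_evenG g : (g \in evenG) = (g \in AutX k) && ~~ bottom_parity g.
Proof. exact: in_set. Qed.

Lemma bottom_parityM g h : g \in AutX k -> h \in AutX k ->
  bottom_parity (g * h) = bottom_parity g (+) bottom_parity h.
Proof.
by move=> gA hA; apply: parityM => // v; rewrite ?size_AutX //; apply: level_lt.
Qed.

Lemma evenG_group_set : group_set evenG.
Proof.
apply/group_setP; split=> [|g h].
  by rewrite in_evenG group1 /bottom_parity /parity big1 // => v /level_lt; apply: active1.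
rewrite !in_evenG => /andP[gA gp] /andP[hA hp].
by rewrite groupM // bottom_parityM // (negbTE gp) (negbTE hp).
Qed.

Canonical evenG_group := Group evenG_group_set.

Lemma tau_evenG : tau k \in evenG.
Proof.
rewrite in_evenG portrait_aut_in /bottom_parity parity_tau; last exact: level_lt.
by rewrite !vtxE ?size_nseq ?eqxx // ltnW.
Qed.

Lemma alpha_evenG i : i < k.-1 -> alpha k i \in evenG.
Proof.
move=> ik; rewrite in_evenG portrait_aut_in alphaE.
have ik' : i < k by apply: ltn_trans ik _.
have e : vtx k (nseq i false) = nseq i false :> seq bool by rewrite vtxE ?size_nseq ?(ltnW ik').
rewrite -e /bottom_parity parity_delta; last exact: level_lt.
by rewrite e size_nseq neq_ltn ik.
Qed.

Lemma S_beta_ind (Q : {perm vertex k} -> Prop) :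
  (forall i, i < k.-1 -> Q (alpha k i)) -> Q (tau k) ->
  forall g, g \in S_beta k -> Q g.
Proof. by move=> Qa Qt g; rewrite !inE => /orP[/imsetP[i _ ->]|/eqP->]; auto. Qed.

Lemma gen_S_beta : K = evenG.
Proof.
apply/eqP; rewrite eqEsubset gen_subG; apply/andP; split.
  by apply/subsetP; apply: S_beta_ind => [i|]; [apply: alpha_evenG | apply: tau_evenG].
apply/subsetP => g; rewrite in_evenG => /andP[gA /negbTE gp].
by have := AutX_coset gA; rewrite gp mulg1.
Qed.

Lemma G_evenG : G_ k = evenG.
Proof.
apply/eqP; rewrite eqEsubset gen_subG subUset; apply/andP; split.
  apply/andP; split; apply/subsetP => g; rewrite in_set in_evenG => /andP[gA].
    move=> /forallP gB; rewrite gA /bottom_parity /parity big1 // => v vl.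
    by have := gB v; rewrite vl => /negbTE.
  by case/andP=> _; rewrite gA odd_card_parity.
rewrite -gen_S_beta; apply: genS; apply/subsetP; apply: S_beta_ind => [i ik|].
  apply/setUP; left; rewrite in_set portrait_aut_in /=.
  apply/forallP=> v; apply/implyP=> /eqP vl; rewrite alphaE active_delta ?vl //.
  by apply: contraTneq ik => /(congr1 size); rewrite vl size_nseq => ->; rewrite ltnn.
have := tau_evenG; rewrite in_evenG => /andP[_ tp].
apply/setUP; right; rewrite in_set portrait_aut_in odd_card_parity tp andbT.
apply/forallP=> v; apply/implyP=> /andP[vk].
by rewrite tau_active // => /orP[] /eqP->; rewrite size_nseq.
Qed.

(** * Homomorphisms dual to S_beta and minimality *)
Definition half b v := (size v == k.-1) && (head false v == b).

Lemma half_lt b v : half b v -> size v < k.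
Proof. by case/andP => /level_lt. Qed.

Lemma parity_half g : parity (half false) g (+) parity (half true) g = bottom_parity g.
Proof.
rewrite /bottom_parity /parity [RHS](bigID (fun v : vertex k => head false v == false)) /=.
by congr (_ (+) _); apply: eq_bigl => v; rewrite /half; case: head.
Qed.

Definition level_char (j : nat) :=
  if j < k.-1 then parity (fun v : vertex k => size v == j) else parity (half false).

(** For the left half, g may exchange the halves; this is harmless because an h
    with an even number of active vertices on level k-1 has the same parity on
    both halves. *)
Lemma level_charM j g h : g \in evenG -> h \in evenG ->
  level_char j (g * h) = level_char j g (+) level_char j h.
Proof.
rewrite !in_evenG => /andP[gA gp] /andP[hA hp]; rewrite /level_char; case: ifP => jk.
  have lj v : size v == j -> size v < k by move/eqP->; apply: ltn_trans jk _.
  by apply: parityM => // v _; rewrite size_AutX.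
have e b : parity (half false) h = parity (half b) h.
  by case: b => //; move: hp; rewrite -parity_half; do 2!case: parity.
rewrite (e (active g (Defs.root k))); apply: parityM => // v; try exact: half_lt.
rewrite /half size_AutX // => _; case: eqP => //= vl.
rewrite AutXE //; case E: (v : seq bool) => [|x s] /=.
  by move: k1_gt0; rewrite -vl E.
by case: x {E}; case: active.
Qed.

Definition beta (i : nat) := if i < k.-1 then alpha k i else tau k.

Lemma beta_evenG i : beta i \in evenG.
Proof. by rewrite /beta; case: ifP => [/alpha_evenG|_] //; exact: tau_evenG. Qed.

Lemma level_char_beta (i j : 'I_k) : level_char j (beta i) = (i == j).
Proof.
have last_ord (x : 'I_k) : (x < k.-1) = false -> x = k.-1 :> nat.
  by have := ltn_ord x; rewrite -[X in _ < X](prednK (ltnW hk)) ltnS leq_eqVlt => /orP[/eqP|->].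
have ez : vtx k zeros = zeros :> seq bool by rewrite vtxE ?size_nseq ?(ltnW k1_lt).
rewrite /level_char /beta; case: (ifP (i < k.-1)) => ik; case: (ifP (j < k.-1)) => jk.
- have e : vtx k (nseq i false) = nseq i false :> seq bool.
    by rewrite vtxE ?size_nseq ?(ltnW (ltn_ord i)).
  rewrite alphaE -e parity_delta ?e ?size_nseq // => v /eqP->.
  exact: ltn_ord.
- have e : vtx k (nseq i false) = nseq i false :> seq bool.
    by rewrite vtxE ?size_nseq ?(ltnW (ltn_ord i)).
  rewrite alphaE -e parity_delta; last exact: half_lt.
  rewrite /half e size_nseq ltn_eqF //=; apply/esym/negbTE.
  by apply: contraFneq jk => <-.
- rewrite parity_tau; last by move=> v /eqP->; exact: ltn_ord.
  by rewrite ez vtx_ones !size_nseq addbb; apply/esym/negbTE; apply: contraFneq ik => ->.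
- rewrite parity_tau; last exact: half_lt.
  rewrite /half ez vtx_ones !size_nseq eqxx /= -(inj_eq val_inj) /=.
  rewrite (last_ord i ik) (last_ord j jk) eqxx.
  by case: k.-1 k1_gt0.
Qed.

(** Sending J to the elements of T on which the sum over J of the
    homomorphisms is odd is injective: these sums are determined by their
    restriction to T, and J is recovered by evaluating at the beta i. *)
Lemma leq_card_gen (T : {set {perm vertex k}}) : <<T>> = evenG -> k <= #|T|.
Proof.
move=> genT; pose ch (J : {set 'I_k}) g := \big[addb/false]_(j in J) level_char j g.
have chM J g h : g \in evenG -> h \in evenG -> ch J (g * h) = ch J g (+) ch J h.
  by move=> gG hG; rewrite /ch -big_split; apply: eq_bigr => j _; rewrite level_charM.
have ch_beta J (i : 'I_k) : ch J (beta i) = (i \in J).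
  rewrite /ch -[RHS](big_addb_pred1 (mem J) i); apply: eq_bigr => j _.
  by rewrite level_char_beta eq_sym.
have ch1 J : ch J 1 = false.
  have := chM J _ _ (group1 evenG_group) (group1 evenG_group).
  by rewrite mulg1; case: (ch J 1).
pose f J := [set t in T | ch J t].
have f_inj : injective f.
  move=> J J' eqf; pose E := [set g in evenG | ch J g == ch J' g].
  have gE : group_set E.
    apply/group_setP; split=> [|g h]; first by rewrite in_set group1 !ch1 eqxx.
    rewrite ![_ \in E]in_set => /andP[gG /eqP gE] /andP[hG /eqP hE].
    by rewrite groupM // !chM // gE hE eqxx.
  have TE : evenG \subset Group gE.
    rewrite -genT gen_subG; apply/subsetP => t tT; rewrite in_set -genT mem_gen //.
    by apply/eqP; move/setP: eqf => /(_ t); rewrite !inE tT.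
  apply/setP => i; rewrite -!ch_beta.
  by have := subsetP TE _ (beta_evenG i); rewrite in_set => /andP[_ /eqP].
rewrite -(leq_exp2l (m := 2)) // -{1}(card_ord k) -cardsT -!card_powerset.
have -> : powerset [set: 'I_k] = [set: {set 'I_k}].
  by apply/setP => J; rewrite !inE subsetT.
rewrite -(card_imset _ f_inj); apply: subset_leq_card; apply/subsetP => _ /imsetP[J _ ->].
by rewrite inE; apply/subsetP => t; rewrite inE => /andP[].
Qed.

Lemma card_S_beta : #|S_beta k| <= k.
Proof.
apply: leq_trans (leq_card_setU _ _) _; rewrite cards1.
rewrite -[X in _ <= X](prednK (ltnW hk)) addn1 ltnS.
by rewrite (leq_trans (leq_imset_card _ _)) ?card_ord.
Qed.

End Generation.

(** * Even permutations and the order of the alternating group *)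

Section EvenPermutations.

Variable T : finType.
Implicit Types (s c : {perm T}) (A : {set T}).

Lemma restr_perm_stable s A x : (forall y, (s y \in A) = (y \in A)) ->
  restr_perm A s x = if x \in A then s x else x.
Proof.
move=> sA; have sN : s \in 'N(A | 'P) by apply/astabsP => y; apply: sA.
case: ifP => xA; first exact: restr_permE.
by apply: (out_perm (restr_perm_on A s)); rewrite xA.
Qed.

(** The restrictions of s to A and to its complement are conjugate under c, so
    they have the same sign. *)
Lemma even_perm_halves s c A : commute s c ->
  (forall x, (s x \in A) = (x \in A)) -> (forall x, (c x \in A) = (x \notin A)) ->
  ~~ odd_perm s.
Proof.
move=> sc sA cA; have sAC x : (s x \in ~: A) = (x \in ~: A) by rewrite !inE sA.
have aE x := restr_perm_stable x sA; have bE x := restr_perm_stable x sAC.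
have -> : s = restr_perm A s * restr_perm (~: A) s.
  apply/permP => x; rewrite permM bE aE !inE.
  by case: (boolP (x \in A)) => xA; rewrite ?sA ?xA.
suff <- : restr_perm A s ^ c = restr_perm (~: A) s.
  by rewrite odd_permM odd_permJ addbb.
apply: (mulgI c); rewrite -conjgC; apply/permP => x; rewrite !permM bE aE !inE cA.
by case: (boolP (x \in A)) => //= xA; rewrite -!permM sc.
Qed.

(** In Legendre's formula the terms beyond the n-th vanish and the others are the
    powers 2 ^ 0, ..., 2 ^ (n - 1). *)
Lemma logn2_fact_exp n : logn 2 (2 ^ n)`! = (2 ^ n).-1.
Proof.
rewrite logn_fact //.
have n2 : n <= 2 ^ n by exact: ltnW (ltn_expl _ _).
rewrite (@big_cat_nat _ _ _ n.+1) //=.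
rewrite [X in (_ + X)%N]big_nat_cond [X in (_ + X)%N]big1 ?addn0; last first.
  by move=> i /andP[/andP[ni _] _]; rewrite divn_small // ltn_exp2l.
rewrite predn_exp mul1n big_add1 /= big_mkord (reindex_inj rev_ord_inj) /=.
apply: eq_bigr => i _; rewrite subnSK // -expnB ?leq_subr // subKn //.
exact: ltnW (ltn_ord i).
Qed.

Lemma Alt_part2 n : 0 < n -> #|T| = (2 ^ n)%N -> (#|'Alt_T|`_2 = 2 ^ (2 ^ n).-2)%N.
Proof.
move=> n0 cT; have T1 : 1 < #|T| by rewrite cT -{1}(expn0 2) ltn_exp2l.
have := congr1 (logn 2) (card_Alt T1).
rewrite lognM ?cardG_gt0 // logn_prime // eqxx cT logn2_fact_exp p_part => e.
by rewrite -e.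
Qed.

End EvenPermutations.

(** * The action on the leaves *)

Section LeafAction.

Variable k : nat.
Hypothesis hk : 2 <= k.
Implicit Types (g h : {perm vertex k}) (u v : vertex k) (w : seq bool).

Local Notation delta := (delta k).

Lemma card_inner : #|[set v : vertex k | size v < k]| = (2 ^ k).-1.
Proof.
pose f (v : k.-1.-bseq bool) : vertex k := vtx k v.
have k0 : 0 < k by exact: ltnW.
have fE x : f x = x :> seq bool.
  by rewrite vtxE // (leq_trans (size_bseq x)) // leq_pred.
have f_inj : injective f by move=> x y /(congr1 val) /=; rewrite !fE => /val_inj.
have -> : [set v : vertex k | size v < k] = f @: [set: k.-1.-bseq bool].
  apply/setP => v; rewrite inE; apply/idP/imsetP => [sv|[u _ ->]]; last first.
    by rewrite fE -[X in _ < X](prednK k0) ltnS size_bseq.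
  have sv' : size v <= k.-1 by rewrite -ltnS prednK.
  by exists (Bseq sv') => //; apply: val_inj; rewrite /= fE.
by rewrite card_imset // cardsT card_bseq card_bool prednK // predn_exp mul1n.
Qed.

(** Automorphisms correspond to sets of inner vertices, their active vertices. *)
Lemma card_AutX : #|AutX k| = (2 ^ (2 ^ k).-1)%N.
Proof.
pose f (A : {set vertex k}) := portrait_aut k (fun w => vtx k w \in A).
pose D := [set v : vertex k | size v < k].
have fP (A : {set vertex k}) v : A \subset D -> active (f A) v && (size v < k) = (v \in A).
  move=> /subsetP AD; have [sv|sv] := ltnP (size v) k.
    by rewrite andbT portrait_autP // vtxK.
  by rewrite andbF; apply/esym/negbTE; apply: contraL sv => /AD; rewrite inE ltnNge.
rewrite -card_inner -/D -card_powerset -(card_in_imset (f := f)); last first.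
  move=> A B; rewrite !inE => AD BD fAB; apply/setP => v.
  by rewrite -!fP // fAB.
apply: eq_card => g; apply/idP/imsetP => [gA|[A _ ->]]; last exact: portrait_aut_in.
exists [set v in D | active g v].
  by rewrite inE; apply/subsetP => v; rewrite inE => /andP[].
apply: AutX_eq => //; first exact: portrait_aut_in.
by move=> v sv; rewrite portrait_autP // vtxK !inE sv.
Qed.

(** By AutX_coset, the automorphisms lie in two cosets of evenG. *)
Lemma card_evenG : 2 ^ (2 ^ k).-1 <= 2 * #|evenG k|.
Proof.
rewrite -card_AutX -(gen_S_beta hk); set d := delta (nseq k.-1 true).
have sub : AutX k \subset <<S_beta k>> :|: <<S_beta k>> :* d.
  apply/subsetP => g gA; have := AutX_coset hk gA; rewrite inE mem_rcoset.
  have -> : d^-1 = d by apply/eqP; rewrite eq_invg_mul deltaK.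
  by case: bottom_parity => /=; rewrite ?mulg1 => ->; rewrite ?orbT.
apply: leq_trans (subset_leq_card sub) _; apply: leq_trans (leq_card_setU _ _) _.
by rewrite card_rcoset mul2n addnn.
Qed.

Definition leaves := [set v : vertex k | size v == k].

Lemma card_leaves : #|leaves| = (2 ^ k)%N.
Proof.
have := cardsC [set v : vertex k | size v < k]; rewrite card_inner card_bseq card_bool.
have -> : ~: [set v : vertex k | size v < k] = leaves.
  by apply/setP => v; rewrite !inE -leqNgt eqn_leq size_bseq.
rewrite big_ord_recr /= -[X in _ = (X + _)%N -> _]mul1n -(predn_exp 2).
exact: addnI.
Qed.

Lemma leaf0_in : vtx k (nseq k false) \in leaves.
Proof. by rewrite inE vtxE ?size_nseq. Qed.

Definition leaf (i : 'I_(2 ^ k)) : vertex k := enum_val (cast_ord (esym card_leaves) i).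
Definition leaf_index v : 'I_(2 ^ k) := cast_ord card_leaves (enum_rank_in leaf0_in v).

Lemma leafK : cancel leaf leaf_index.
Proof. by move=> i; rewrite /leaf_index enum_valK_in cast_ordKV. Qed.

Lemma leaf_indexK : {in leaves, cancel leaf_index leaf}.
Proof. by move=> v vL; rewrite /leaf cast_ordK enum_rankK_in. Qed.

Lemma size_leaf i : size (leaf i) = k.
Proof. by have := enum_valP (cast_ord (esym card_leaves) i); rewrite inE => /eqP. Qed.

(** Made the identity off AutX, where g need not preserve the leaves, so that it
    is injective for every g. *)
Definition leaf_fun g i := if g \in AutX k then leaf_index (g (leaf i)) else i.

Lemma leaf_funE g i : g \in AutX k -> leaf (leaf_fun g i) = g (leaf i).
Proof.
move=> gA; rewrite /leaf_fun gA leaf_indexK //.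
by rewrite inE size_AutX // size_leaf.
Qed.

Lemma leaf_fun_inj g : injective (leaf_fun g).
Proof.
move=> i j e; case: (boolP (g \in AutX k)) => gA; last first.
  by move: e; rewrite /leaf_fun (negbTE gA).
by apply/(can_inj leafK)/(@perm_inj _ g); rewrite -!leaf_funE // e.
Qed.

Definition leaf_perm g : {perm 'I_(2 ^ k)} := perm (@leaf_fun_inj g).

Lemma leaf_permE g i : g \in AutX k -> leaf (leaf_perm g i) = g (leaf i).
Proof. by move=> gA; rewrite permE leaf_funE. Qed.

Lemma leaf_permM : {in AutX k &, {morph leaf_perm : g h / g * h}}.
Proof.
move=> g h gA hA; apply/permP => i; apply: (can_inj leafK).
by rewrite permM !leaf_permE ?groupM // permM.
Qed.

Canonical leaf_perm_morphism := Morphism leaf_permM.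

Lemma leaf_perm_inj : 'injm leaf_perm.
Proof.
apply/injmP => g h gA hA e; apply/permP => v; apply: val_inj => /=.
pose l := vtx k (v ++ nseq (k - size v) false).
have sl : size (v ++ nseq (k - size v) false) = k.
  by rewrite size_cat size_nseq subnKC // size_bseq.
have lE : l = v ++ nseq (k - size v) false :> seq bool by rewrite vtxE ?sl.
have gE f : f \in AutX k -> f v = take (size v) (f l) :> seq bool.
  move=> fA; rewrite !AutXE // lE act_from_cat take_size_cat //.
  by rewrite size_act_from.
have lL : l \in leaves by rewrite inE lE sl.
by rewrite !gE // -(leaf_indexK lL) -!leaf_permE // e.
Qed.

(** u is the parent of v; it is left unnamed since only its level matters. *)
Lemma last_AutX v : size v = k -> exists2 u : vertex k, size u = k.-1 &
  forall g, g \in AutX k -> last false (g v) = last false v (+) active g u.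
Proof.
case/lastP E: (v : seq bool) => [|w x] /=.
  by move=> k0; have := ltnW hk; rewrite -{1}k0.
rewrite size_rcons => sw; have wk : size w < k by rewrite -sw.
have wE := vtxE (ltnW wk).
exists (vtx k w); first by rewrite wE -sw.
move=> g gA; have := AutX_vtx_rcons (v := vtx k w) x gA; rewrite wE => /(_ wk) gE.
have -> : v = vtx k (rcons w x) by rewrite -E vtxK.
by rewrite gE !last_rcons.
Qed.

(** Such a g preserves the last letter of each leaf and does not depend on it: it
    commutes with the flip c of that letter, so even_perm_halves applies. *)
Lemma leaf_perm_upper g : g \in AutX k ->
  (forall v, size v = k.-1 -> ~~ active g v) -> ~~ odd_perm (leaf_perm g).
Proof.
move=> gA gU; pose c := portrait_aut k (fun w => size w == k.-1).
have cA : c \in AutX k by exact: portrait_aut_in.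
have k1 : k.-1 < k by rewrite prednK // ltnW.
have gc : g * c = c * g.
  apply: AutX_eq; rewrite ?groupM // => v sv.
  have cv : c v = v.
    apply: (AutX_below_fix (n := k.-1)) => // [u su uk|]; last first.
      by rewrite -ltnS prednK // ltnW.
    by rewrite portrait_autP // neq_ltn su.
  by rewrite !activeM // cv !portrait_autP ?size_AutX // addbC.
pose A := [set i | last false (leaf i)].
have AE f i : f \in AutX k -> exists2 u : vertex k, size u = k.-1 &
    (leaf_perm f i \in A) = (i \in A) (+) active f u.
  move=> fA; have [u su uP] := last_AutX (size_leaf i).
  by exists u => //; rewrite !inE leaf_permE // uP.
apply: (@even_perm_halves _ _ (leaf_perm c) A).
- by rewrite /commute -!leaf_permM // gc.
- by move=> i; have [u su ->] := AE g i gA; rewrite (negbTE (gU u su)) addbF.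
- move=> i; have [u su ->] := AE c i cA.
  by rewrite portrait_autP su ?eqxx ?addbT.
Qed.

(** spine ones maps the first vertex of level k-1 to the last one, so tau is the
    product of two conjugates. *)
Lemma leaf_perm_tau : ~~ odd_perm (leaf_perm (tau k)).
Proof.
have k1 := k1_lt hk.
pose z := vtx k (nseq k.-1 false); pose h := spine k (nseq k.-1 true).
have zE : z = nseq k.-1 false :> seq bool by rewrite vtxE ?size_nseq ?(ltnW k1).
have oE : vtx k (nseq k.-1 true) = nseq k.-1 true :> seq bool.
  by rewrite vtxE ?size_nseq ?(ltnW k1).
have hA : h \in AutX k by exact: spine_in.
have hz : h z = vtx k (nseq k.-1 true).
  by have := spine_zeros (vtx k (nseq k.-1 true)); rewrite /= oE size_nseq.
rewrite tauE // -oE -hz -zE -deltaJ //; last first.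
  move=> u; rewrite zE size_nseq => /leq_ltn_trans/[apply].
  by rewrite prednK ?ltnn // ltnW.
rewrite leaf_permM ?groupJ ?delta_in // odd_permM.
rewrite (morphJ leaf_perm_morphism) ?delta_in // odd_permJ.
by rewrite addbb.
Qed.

Lemma leaf_perm_Alt : leaf_perm @* evenG k \subset 'Alt_('I_(2 ^ k)).
Proof.
rewrite -(gen_S_beta hk).
have SA : S_beta k \subset AutX k.
  by apply/subsetP; apply: S_beta_ind => [i _|]; apply: portrait_aut_in.
rewrite morphim_gen // gen_subG; apply/subsetP => _ /morphimP[g _ gS ->].
rewrite Alt_even; move: g gS; apply: S_beta_ind => [i ik|]; last exact: leaf_perm_tau.
apply: leaf_perm_upper => [|v sv]; first exact: portrait_aut_in.
have k1 := k1_lt hk.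
rewrite alphaE active_delta ?sv //.
by apply: contraTneq ik => /(congr1 size); rewrite sv size_nseq => ->; rewrite ltnn.
Qed.

(** The image is a 2-group because AutX is one, so its order divides the 2-part of
    the order of Alt, and card_evenG shows that it is not smaller. *)
Lemma leaf_perm_Sylow : 2.-Sylow('Alt_('I_(2 ^ k))) (leaf_perm @* evenG k).
Proof.
have GA : evenG k \subset AutX k by apply/subsetP => g; rewrite in_evenG => /andP[].
rewrite pHallE leaf_perm_Alt /= card_injm ?leaf_perm_inj //.
rewrite (Alt_part2 (n := k)) ?card_ord ?(ltnW hk) // eqn_leq.
have G2 : 2.-nat #|evenG k|.
  have dvdA : #|evenG k| %| #|AutX k| by exact: (@cardSg _ (AutX_group k) (evenG_group hk) GA).
  by apply: pnat_dvd dvdA _; rewrite card_AutX pnatX pnat_id.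
have e2 : (2 ^ k).-1 = (2 ^ k).-2.+1.
  by rewrite prednK // -subn1 subn_gt0 -{1}(expn0 2) ltn_exp2l // ltnW.
apply/andP; split; last first.
  by have := card_evenG; rewrite e2 expnS leq_pmul2l.
rewrite -(part_pnat_id G2) dvdn_leq //; first by rewrite expn_gt0.
rewrite -(@Alt_part2 'I_(2 ^ k) k) ?card_ord ?(ltnW hk) // partn_dvd ?cardG_gt0 //.
by rewrite -(card_injm leaf_perm_inj GA) cardSg // leaf_perm_Alt.
Qed.

End LeafAction.

Theorem mainTheorem1 (k : nat) (hk : 2 <= k) :
  (<<S_beta k>> = G_ k
   /\ forall T : {set {perm vertex k}}, <<T>> = G_ k -> #|S_beta k| <= #|T|)
  /\ exists P : {group {perm 'I_(2 ^ k)}},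
       2.-Sylow('Alt_('I_(2 ^ k))) P /\ G_ k \isog P.
Proof.
rewrite G_evenG // gen_S_beta //; split; first split=> // T genT.
  exact: leq_trans (card_S_beta hk) (leq_card_gen hk genT).
exists (leaf_perm_morphism hk @* evenG_group hk)%G; split; first exact: leaf_perm_Sylow.
apply: sub_isog (leaf_perm_inj hk).
by apply/subsetP => g; rewrite in_evenG => /andP[].
Qed.
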